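(* Let $X$, $Y$ and $Z$ be finite dimensional real normed spaces. Let $g:X\to Y$ be a mapping which is locally Lipschitzian around $\bar{x}\in X$, put $\bar{y}=g(\bar{x})$, and let $\varphi:X\times Y\to Z$ be a mapping which is strictly Hadamard differentiable at $(\bar{x},\bar{y})$ with bijective derivative $D\varphi(\bar{x},\bar{y})$. Let $S\subset Z$ be a closed set such that $S\cap\Omega=\varphi(\mathrm{graph}\,g)\cap\Omega$, where $\Omega\subset Z$ is an open set containing $\bar{z}:=\varphi(\bar{x},\bar{y})$. Then the following assertions are equivalent: 1) $g$ is strictly Hadamard differentiable at $\bar{x}$; 2') the set-valued mapping $z\rightrightarrows K(S,z)$ is continuous at $\bar{z}$ with respect to $S$, and the contingent cone $K(S,\bar{z})$ is isomorphic to $X$.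
   Context: $\mathrm{graph}\,g=\{(x,g(x)):x\in X\}\subset X\times Y$. For a set $A$ in a normed space, $d_A(h)=\inf_{u\in A}\|u-h\|$. Contingent (Bouligand) cone: for a closed set $S\subset Z$ and $z\in S$, $K(S,z)=\limsup_{t\to0^+}\frac{S-z}{t}=\{h\in Z:\liminf_{t\to0^+}d_{(S-z)/t}(h)=0\}$, i.e. the set of $h\in Z$ for which there exist $t_n\to0^+$ and $h_n\to h$ with $z+t_nh_n\in S$ for all $n$. Limits of a set-valued mapping $F$ with values in $Z$, defined on $S$, as $z\to\bar{z}$ with respect to $S$: $\limsup_{z\to\bar{z}}F(z)=\{h\in Z:\liminf_{z\to\bar{z},\,z\in S}d_{F(z)}(h)=0\}$ and $\liminf_{z\to\bar{z}}F(z)=\{h\in Z:\lim_{z\to\bar{z},\,z\in S}d_{F(z)}(h)=0\}$. $F$ is continuous at $\bar{z}$ with respect to $S$ if both of these sets are equal to $F(\bar{z})$. Strict Hadamard differentiability: a mapping $g:X\to Y$ between normed spaces is strictly Hadamard differentiable at $\bar{x}$ if there is a continuous linear map $Dg(\bar{x}):X\to Y$ (the strict Hadamard derivative) such that, for every $h\in X$, $\frac{g(x+tu)-g(x)}{t}\to Dg(\bar{x})(h)$ as $t\to0^+$, $x\to\bar{x}$, $u\to h$. ''$K(S,\bar{z})$ is isomorphic to $X$'' means that $K(S,\bar{z})$ is a linear subspace of $Z$ and there is a linear isomorphism from $X$ onto it.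
   Formalization: Added, for both implications: for every neighbourhood W of (x̄,ȳ), the points of φ(graph g) near z̄ are images of points of graph g in W; without this, far parts of the graph may map to other curves through z̄, and 1) does not imply 2'). *)

(* Defs.v *)
From HB Require Import structures.
From mathcomp Require Import all_boot all_order all_algebra.
From mathcomp Require Import all_classical all_reals all_analysis.

Set Implicit Arguments.
Unset Strict Implicit.
Unset Printing Implicit Defensive.

Import Order.TTheory GRing.Theory Num.Theory.
Import numFieldNormedType.Exports.

Local Open Scope classical_set_scope.
Local Open Scope ring_scope.

(* Finite dimensional normed spaces: the join of the normed modules with the
   (finite dimensional) vectTypes; the norm is arbitrary. *)
#[short(type="normedVectType")]
HB.structure Definition NormedVector (K : numFieldType) :=
  {V of NormedModule K V & Vector K V}.

Definition graph_of (X Y : Type) (g : X -> Y) : set (X * Y) :=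
  range (fun x => (x, g x)).

Section SetLimits.
Context {R : realType} {Z : normedModType R}.
Implicit Types (A S : set Z) (h z : Z).

(* Extended-real valued, so that the distance to the empty set is +oo. *)
Definition dist_to A h : \bar R := ereal_inf [set `|u - h|%:E | u in A].

Definition set_limsup {T : topologicalType} (F : T -> set Z)
    (G : set_system T) : set Z :=
  [set h | limf_einf (fun t => dist_to (F t) h) G = 0%E].

Definition set_liminf {T : topologicalType} (F : T -> set Z)
    (G : set_system T) : set Z :=
  [set h | dist_to (F t) h @[t --> G] --> 0%E].

Definition contingent_cone S z : set Z :=
  set_limsup (fun t : R => [set t^-1 *: (s - z) | s in S]) 0^'+.

(* The neighbourhoods are not punctured: z = zbar is allowed in z --> zbar, so
   that an isolated point zbar of S causes no degeneracy. *)
Definition set_continuous_at_wrt S (F : Z -> set Z) (zbar : Z) : Prop :=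
  set_limsup F (within S (nbhs zbar)) = F zbar /\
  set_liminf F (within S (nbhs zbar)) = F zbar.

End SetLimits.

Section StrictHadamard.
Context {R : realType} {X Y : normedModType R}.

(* The filter variable is the triple ((t, x), u). *)
Definition is_strict_hadamard_derivative (g : X -> Y) (xbar : X)
    (D : {linear X -> Y}) : Prop :=
  continuous D /\
  forall h : X,
    p.1.1^-1 *: (g (p.1.2 + p.1.1 *: p.2) - g p.1.2)
      @[p --> filter_prod (filter_prod (0 : R)^'+ (nbhs xbar)) (nbhs h)]
      --> D h.

Definition strictly_hadamard_differentiable (g : X -> Y) (xbar : X) : Prop :=
  exists D : {linear X -> Y}, is_strict_hadamard_derivative g xbar D.

Definition locally_lipschitz_around (g : X -> Y) (xbar : X) : Prop :=
  exists2 U : set X, nbhs xbar U & [lipschitz g x | x in U].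

End StrictHadamard.

Definition is_subspace_isomorphic_to {R : realType} {Z : normedModType R}
    (A : set Z) (X : normedModType R) : Prop :=
  submod_closed [pred z | z \in A] /\
  exists L : {linear X -> Z}, set_bij [set: X] A L.

(* Near (phi p), the set phi(G) consists of images of points of G near p.
   Strict differentiability at p says nothing about phi far from p, so that
   phi(G) may otherwise contain unrelated pieces accumulating at (phi p).
   It holds, for instance, when phi is injective and, near p, a
   homeomorphism onto a neighbourhood of (phi p). *)
Definition image_localized_at {T U : topologicalType} (phi : T -> U)
    (G : set T) (p : T) : Prop :=
  forall W : set T, nbhs p W ->
    \forall z \near phi p, (phi @` G) z -> (phi @` (G `&` W)) z.

(* Main.v *)
Require Import Defs.
From HB Require Import structures.
From mathcomp Require Import all_boot all_order all_algebra.
From mathcomp Require Import all_classical all_reals all_analysis.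
From mathcomp Require Import ring lra.
Import numFieldNormedType.Exports.
Import Order.TTheory GRing.Theory Num.Theory.

(* In finite dimension strict Hadamard differentiability is uniform on the
   sphere, hence is strict Frechet differentiability.  Near zbar, S is the image
   of the bi-Lipschitz map psi x = phi (x, g x), and
   psi b - psi a = D (b - a, g b - g a) + o(|b - a|), where D is the derivative
   of phi.

   If g has strict derivative A, then psi has the injective strict derivative
   L u = D (u, A u): elements of K(S, z) for z near zbar are limits of
   difference quotients of psi, hence close to the range of L, and conversely
   difference quotients in the direction u have, by compactness, cluster points
   close to L u, which lie in K(S, z).

   Conversely, D^-1 K(S, zbar) contains no vertical vector since g is Lipschitz,
   so that, having the dimension of X, it is the graph of a linear map A.  Upper
   semicontinuity and compactness of the sphere put K(S, z) uniformly close to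
   K(S, zbar) for z near zbar; hence at every point x near xbar, in every
   direction w, some small increments of g - A along w are at most e |w| per
   unit of time.  The mean value inequality for Dini derivates then bounds the
   increments of g - A on segments, which is strict differentiability. *)

Local Open Scope classical_set_scope.
Local Open Scope ring_scope.

(** * Finite dimensional normed spaces *)

Lemma rV_sum_continuous {R : realType} {V : normedModType R} {n : nat}
    (b : 'I_n -> V) :
  continuous (fun r : 'rV[R]_n => \sum_(i < n) r ord0 i *: b i).
Proof.
apply: (continuous_big add_continuous) => i _ r.
apply: (@cvgZr_tmp _ _ _ (nbhs r) (nbhs_filter r)).
exact: (@coord_continuous R 1 n ord0 i r).
Qed.

Section FiniteDimensional.
Context {R : realType} {V : normedVectType R}.

(** The map from coordinates to vectors is continuous and injective, so its norm has a positive
    minimum on the compact unit sphere of row vectors. Homogeneity extends this to all vectors,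
    which compares the arbitrary norm of [V] with the coordinates. *)
Lemma coord_vbasis_bound :
  exists2 m : R, 0 < m &
    forall (v : V) i, m * `|coord (vbasis fullv) i v| <= `|v|.
Proof.
pose b := vbasis (fullv : {vspace V}).
pose n := \dim (fullv : {vspace V}).
pose F (r : 'rV[R]_n) : V := \sum_(i < n) r ord0 i *: b`_i.
have Fcont : continuous F.
  exact: (rV_sum_continuous (fun i : 'I_n => b`_i)).
have FZ a r : F (a *: r) = a *: F r.
  by rewrite /F scaler_sumr; apply: eq_bigr => i _; rewrite mxE scalerA.
have Finj r : F r = 0 -> r = 0.
  move=> Fr0; apply/rowP => i; rewrite mxE.
  have /freeP : free b by exact: basis_free (vbasisP _).
  by apply.
have vF v : F (\row_i coord b i v) = v.
  rewrite /F [RHS](coord_vbasis (memvf v)); apply: eq_bigr => i _.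
  by rewrite mxE.
have sphere_compact : compact [set r : 'rV[R]_n | `|r| = 1].
  apply: bounded_closed_compact.
    exists 1; split; first exact: num_real.
    by move=> M M1 r /= ->; exact: ltW.
  apply: (@preimage_closed _ _ (@Num.norm _ 'rV[R]_n) [set 1]).
    by move=> r _; exact: norm_continuous.
  exact: closed_eq.
suff [m m0 Fm] : exists2 m : R, 0 < m & forall r, m * `|r| <= `|F r|.
  exists m => // v i; rewrite -[in leRHS](vF v); apply: le_trans (Fm _).
  rewrite ler_pM2l//.
  have /mapP[j _ ij] : `|(\row_i coord b i v) ord0 i| \in
      [seq `|(\row_i coord b i v) x.1 x.2| | x : 'I_1 * 'I_n].
    by apply/mapP; exists (ord0, i) => //=; rewrite mem_enum.
  rewrite [leRHS]/Num.norm /= mx_normrE; apply/bigmax_geP; right => /=.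
  by exists (ord0, i) => //=; rewrite mxE.
(* In dimension zero the sphere is empty and there is no minimum to take; every row vector is then
   zero and any constant will do. *)
have [S0|S0] := pselect ([set r : 'rV[R]_n | `|r| = 1] !=set0); last first.
  exists 1 => // r; have [->|r0] := eqVneq r 0.
    by rewrite normr0 mulr0 normr_ge0.
  exfalso; apply: S0; exists (`|r|^-1 *: r).
  by rewrite /= normrZ normfV normr_id mulVf// normr_eq0.
have [|r0] := @compact_EVT_min _ R (fun r => `|F r|) _ S0 sphere_compact.
  apply: continuous_subspaceT => r.
  by apply: cvg_comp (Fcont r) _; exact: norm_continuous.
rewrite inE /= => r01 rmin; exists `|F r0|.
  rewrite normr_gt0; apply/eqP => /Finj r00.
  by move: r01; rewrite r00 normr0 => /esym/eqP; rewrite oner_eq0.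
move=> r; have [->|rN0] := eqVneq r 0; first by rewrite normr0 mulr0 normr_ge0.
have /rmin : `|r|^-1 *: r \in [set r : 'rV[R]_n | `|r| = 1].
  by rewrite inE /= normrZ normfV normr_id mulVf// normr_eq0.
by rewrite FZ normrZ normfV normr_id ler_pdivlMl ?normr_gt0// mulrC.
Qed.

(** By [coord_vbasis_bound] the ball is a closed subset of the continuous image of a cube of
    coordinates, which is compact. *)
Lemma compact_norm_le (M : R) : compact [set v : V | `|v| <= M].
Proof.
have [m m0 mV] := coord_vbasis_bound.
pose b := vbasis (fullv : {vspace V}).
pose n := \dim (fullv : {vspace V}).
pose F (r : 'rV[R]_n) : V := \sum_(i < n) r ord0 i *: b`_i.
have Fcont : continuous F.
  exact: (rV_sum_continuous (fun i : 'I_n => b`_i)).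
apply: (@subclosed_compact V _
  (F @` [set r : 'rV[R]_n | forall i, `[- (M / m), M / m]%classic (r ord0 i)])).
- apply: (@preimage_closed _ _ (@Num.norm _ V) [set x | x <= M]).
    by move=> r _; exact: norm_continuous.
  exact: closed_le.
- apply: continuous_compact; first exact: continuous_subspaceT.
  apply: (@rV_compact _ _ (fun=> `[- (M / m), M / m]%classic)) => i.
  exact: segment_compact.
- move=> v /= vM; exists (\row_i coord b i v).
    move=> i /=; rewrite mxE in_itv /= -ler_norml ler_pdivlMr// mulrC.
    exact: le_trans (mV _ _) vM.
  rewrite /F [RHS](coord_vbasis (memvf v)); apply: eq_bigr => i _.
  by rewrite mxE.
Qed.

Lemma compact_norm_eq1 : compact [set v : V | `|v| = 1].
Proof.
apply: (@subclosed_compact _ _ [set v : V | `|v| <= 1]).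
- apply: (@preimage_closed _ _ (@Num.norm _ V) [set 1]).
    by move=> r _; exact: norm_continuous.
  exact: closed_eq.
- exact: compact_norm_le.
- by move=> v /= ->.
Qed.

Context {W : normedModType R}.

Lemma linear_norm_le (f : {linear V -> W}) :
  exists2 C : R, 0 < C & forall v, `|f v| <= C * `|v|.
Proof.
have [m m0 mV] := coord_vbasis_bound.
pose b := vbasis (fullv : {vspace V}).
exists (1 + (\sum_(i < \dim (fullv : {vspace V})) `|f b`_i|) / m).
  rewrite ltr_pwDl//; apply: divr_ge0; last exact: ltW.
  exact: sumr_ge0.
move=> v; rewrite {1}(coord_vbasis (memvf v)) linear_sum.
apply: (le_trans (ler_norm_sum _ _ _)).
apply: (@le_trans _ _
  ((\sum_(i < \dim (fullv : {vspace V})) `|f b`_i|) / m * `|v|)); last first.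
  by rewrite ler_wpM2r// lerDr.
rewrite mulrAC ler_pdivlMr// !mulr_suml; apply: ler_sum => i _.
rewrite linearZ /= normrZ mulrC mulrA mulrC ler_wpM2l//; exact: mV.
Qed.

Lemma linear_continuous_fd (f : {linear V -> W}) : continuous f.
Proof.
have [C C0 fC] := linear_norm_le f.
move=> x; apply/cvgrPdist_le => e e0; apply/nbhs_ballP.
exists (e / C) => [|y]; first exact: divr_gt0.
rewrite -ball_normE /= => /ltW xy; rewrite -linearB.
by apply: (le_trans (fC _)); rewrite -ler_pdivlMl// mulrC.
Qed.

(** The constant is the minimum of [|f v|] on the unit sphere, positive by injectivity. *)
Lemma injective_linear_norm_ge (f : {linear V -> W}) :
  (forall v, f v = 0 -> v = 0) ->
  exists2 c : R, 0 < c & forall v, c * `|v| <= `|f v|.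
Proof.
move=> f_inj.
have normalized (v : V) : v != 0 -> `| `|v|^-1 *: v| = 1.
  by move=> v0; rewrite normrZ normfV normr_id mulVf// normr_eq0.
have [S0|S0] := pselect ([set v : V | `|v| = 1] !=set0); last first.
  exists 1 => // v; have [->|v0] := eqVneq v 0.
    by rewrite normr0 mulr0 normr_ge0.
  by exfalso; apply: S0; exists (`|v|^-1 *: v); exact: normalized.
have [|v0] := @compact_EVT_min _ R (fun v => `|f v|) _ S0 compact_norm_eq1.
  apply: continuous_subspaceT => v.
  by apply: cvg_comp (linear_continuous_fd f v) _; exact: norm_continuous.
rewrite inE /= => v01 vmin; exists `|f v0|.
  rewrite normr_gt0; apply/eqP => /f_inj v00.
  by move: v01; rewrite v00 normr0 => /esym/eqP; rewrite oner_eq0.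
move=> v; have [->|vN0] := eqVneq v 0; first by rewrite normr0 mulr0 normr_ge0.
have /vmin : `|v|^-1 *: v \in [set v : V | `|v| = 1].
  by rewrite inE; exact: normalized.
by rewrite linearZ /= normrZ normfV normr_id ler_pdivlMl ?normr_gt0// mulrC.
Qed.

(** Points of the range within distance 1 of [h] have preimages of norm at most [(|h| + 1) / c].
    Thus [h] is a closure point of the image of a compact ball, which is closed. *)
Lemma range_injective_linear_closed (f : {linear V -> W}) :
  (forall v, f v = 0 -> v = 0) -> closed (range f).
Proof.
move=> f_inj h clh; have [c c0 fc] := injective_linear_norm_ge f f_inj.
pose B := f @` [set v : V | `|v| <= (`|h| + 1) / c].
have : closed B.
  apply: compact_closed; first exact: norm_hausdorff.
  apply: continuous_compact; last exact: compact_norm_le.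
  exact/continuous_subspaceT/linear_continuous_fd.
move=> /(_ h) []; last by move=> v _ <-; exists v.
move=> U Uh.
have [w [[v _ <-] [Uv vh]]] := clh _ (filterI Uh (nbhsx_ballx h 1 ltr01)).
exists (f v); split=> //; exists v => //=.
rewrite ler_pdivlMr// mulrC; apply: (le_trans (fc v)).
move: vh; rewrite -ball_normE /= distrC => vh.
by rewrite -lerBlDl; apply: le_trans (ltW vh); exact: lerB_dist.
Qed.

End FiniteDimensional.

(** * Limits of set-valued maps, contingent cones and strict derivatives *)

Lemma nbhs_right0_lt {R : realType} {d : R} :
  0 < d -> \forall t \near 0^'+, 0 < t < d.
Proof.
move=> d0; near=> t; apply/andP; split; near: t.
  exact: nbhs_right_gt.
exact: nbhs_right_lt.
Unshelve. all: by end_near. Qed.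

(** Half of the radius is spent on the base point and half on the increment; this keeps short moves
    along a bounded direction inside a ball. *)
Lemma ltr_norm_shift {R : realType} {V : normedModType R}
    {x y u : V} {d t M : R} :
  `|x - y| < d / 2 -> `|u| <= M -> 0 < M -> 0 < t < d / 2 / M ->
  `|x + t *: u - y| < d.
Proof.
move=> xy uM M0 /andP[t0 td].
rewrite addrAC (splitr d) (le_lt_trans (ler_normD _ _))// ltrD//.
rewrite normrZ gtr0_norm//; apply: (@le_lt_trans _ _ (t * M)).
  by rewrite ler_wpM2l// ltW.
by rewrite -ltr_pdivlMr.
Qed.

Section SetLimitsCharacterization.
Context {R : realType} {Z : normedModType R}.
Implicit Types (A S : set Z) (h z : Z).

Lemma dist_to_ge0 A h : (0 <= dist_to A h)%E.
Proof. by apply/ereal_infP => _ [u _ <-]; rewrite lee_fin. Qed.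

Lemma dist_to_ltP A h (e : R) :
  (dist_to A h < e%:E)%E <-> exists2 u, A u & `|u - h| < e.
Proof.
split=> [/ereal_inf_ltP[_ [u Au <-]]|[u Au uh]].
  by rewrite lte_fin => uh; exists u.
by apply/ereal_inf_ltP; exists `|u - h|%:E; [exists u|rewrite lte_fin].
Qed.

Lemma set_limsupP {T : topologicalType} (F : T -> set Z) (G : set_system T) :
  Filter G -> forall h, set_limsup F G h <->
    forall (e : R) (B : set T), 0 < e -> G B ->
      exists2 t, B t & exists2 u, F t u & `|u - h| < e.
Proof.
move=> FG h; rewrite /set_limsup /= limf_einfE; split=> [le0 e B e0 GB|near_h].
  have : (ereal_inf ((fun t => dist_to (F t) h) @` B) < e%:E)%E.
    apply: (@le_lt_trans _ _ 0%E); last by rewrite lte_fin.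
    by rewrite -le0; apply: ereal_sup_ubound; exists B.
  by case/ereal_inf_ltP => _ [t Bt <-] /dist_to_ltP tu; exists t.
apply/eqP; rewrite eq_le; apply/andP; split; last first.
  apply: (@le_trans _ _ (ereal_inf ((fun t => dist_to (F t) h) @` setT))).
    by apply/ereal_infP => _ [t _ <-]; exact: dist_to_ge0.
  by apply: ereal_sup_ubound; exists setT => //; exact: filterT.
apply: ge_ereal_sup => _ [B GB <-]; apply/lee_addgt0Pr => e e0; rewrite add0e.
have [t Bt /dist_to_ltP tu] := near_h e B e0 GB.
by apply: le_trans (ltW tu); apply: ereal_inf_lbound; exists t.
Qed.

Lemma set_liminfP {T : topologicalType} (F : T -> set Z) (G : set_system T) :
  Filter G -> forall h, set_liminf F G h <->
    forall e : R, 0 < e -> \forall t \near G, exists2 u, F t u & `|u - h| < e.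
Proof.
move=> FG h; rewrite /set_liminf /=; split=> [cvg0 e e0|near_h].
  have /cvg0 : nbhs (0%E : \bar R) [set x : \bar R | (x < e%:E)%E].
    by apply: open_ereal_lt'; rewrite lte_fin.
  by apply: (@filterS _ G) => t /dist_to_ltP.
(* Distances may be [+oo]. They are eventually below 1, hence finite, and convergence can be checked
   on real values. *)
apply/fine_cvgP; split.
  apply: filterS (near_h 1 ltr01) => t /dist_to_ltP t1.
  by rewrite ge0_fin_numE ?dist_to_ge0// (lt_trans t1)// ltry.
apply/cvgrPdist_le => e e0; apply: filterS (near_h e e0) => t /dist_to_ltP te.
rewrite /= sub0r normrN ger0_norm ?fine_ge0 ?dist_to_ge0//.
rewrite -lee_fin fineK ?(ltW te)//.
by rewrite ge0_fin_numE ?dist_to_ge0// (lt_trans te)// ltry.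
Qed.

Lemma contingent_coneP S z h : contingent_cone S z h <->
  forall e d : R, 0 < e -> 0 < d ->
    exists2 t, 0 < t < d & exists2 s, S s & `|t^-1 *: (s - z) - h| < e.
Proof.
rewrite /contingent_cone set_limsupP; split=> [K e d e0 d0|K e B e0].
  have [t td [_ [s Ss <-] sh]] := K e [set t | 0 < t < d] e0 (nbhs_right0_lt d0).
  by exists t => //; exists s.
case/nbhs_ballP => d /= d0 dB.
have [t /andP[t0 td] [s Ss sh]] := K e d e0 d0.
exists t; last by exists (t^-1 *: (s - z)) => //; exists s.
by apply: dB => //=; rewrite -ball_normE /= sub0r normrN gtr0_norm.
Qed.

(** The same point [s] serves, with [t] replaced by [t / a]. *)
Lemma contingent_coneZ S z h (a : R) : 0 < a ->
  contingent_cone S z h -> contingent_cone S z (a *: h).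
Proof.
move=> a0 /contingent_coneP K; apply/contingent_coneP => e d e0 d0.
have [||t /andP[t0 td] [s Ss sh]] := K (e / a) (d * a).
- exact: divr_gt0.
- exact: mulr_gt0.
exists (t / a); first by rewrite divr_gt0//= ltr_pdivrMr.
exists s => //; rewrite invfM invrK (mulrC t^-1) -scalerA -scalerBr normrZ.
rewrite gtr0_norm//.
by rewrite mulrC -ltr_pdivlMr.
Qed.

Lemma contingent_cone_closed S z h :
  (forall e : R, 0 < e -> exists2 k, contingent_cone S z k & `|k - h| < e) ->
  contingent_cone S z h.
Proof.
move=> near_h; apply/contingent_coneP => e d e0 d0.
have e20 : 0 < e / 2 by rewrite divr_gt0.
have [k /contingent_coneP Kk kh] := near_h _ e20.
have [t td [s Ss sk]] := Kk _ _ e20 d0.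
exists t => //; exists s => //.
by rewrite -(subrKA k) (splitr e) (le_lt_trans (ler_normD _ _))// ltrD.
Qed.

(** The neighbourhoods are not punctured, so [z] itself is an admissible nearby point. *)
Lemma subset_set_limsup_within S z (F : Z -> set Z) :
  S z -> F z `<=` set_limsup F (within S (nbhs z)).
Proof.
move=> Sz h Fh; apply/set_limsupP => e B e0 SB; exists z.
  exact: (nbhs_singleton SB).
by exists h => //; rewrite subrr normr0.
Qed.

(** Evaluating the limit condition at [z] itself approximates [h] by elements of the cone at [z],
    which is closed. *)
Lemma set_liminf_within_sub_cone S z : S z ->
  set_liminf (contingent_cone S) (within S (nbhs z)) `<=` contingent_cone S z.
Proof.
move=> Sz h /set_liminfP hS; apply: contingent_cone_closed => e e0.
exact: (nbhs_singleton (hS e e0)).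
Qed.

End SetLimitsCharacterization.

(** [D] is a bare function, so that expressions such as [fun u => D (u, A u)] fit without a bundled
    linear structure. *)
Definition strict_frechet_derivative {R : realType} {U V : normedModType R}
    (f : U -> V) (x : U) (D : U -> V) : Prop :=
  forall e : R, 0 < e -> exists2 d : R, 0 < d &
    forall a b, `|a - x| < d -> `|b - x| < d ->
      `|f b - f a - D (b - a)| <= e * `|b - a|.

(** * Strict Hadamard versus strict Frechet differentiability *)

Section StrictHadamardFrechet.
Context {R : realType}.

(** Compactness of the unit sphere makes the Hadamard limit uniform over unit directions. It is then
    read at time [|b - a|], base point [a] and the normalized direction of [b - a]. *)
Lemma strict_hadamard_frechet {U : normedVectType R} {V : normedModType R}
    (f : U -> V) (x : U) (D : {linear U -> V}) :
  is_strict_hadamard_derivative f x D -> strict_frechet_derivative f x D.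
Proof.
move=> [Dcont fD] e e0.
have : \forall p \near filter_prod (0 : R)^'+ (nbhs x),
    [set u : U | `|u| = 1] `<=`
    [set u | `|p.1^-1 *: (f (p.2 + p.1 *: u) - f p.2) - D u| <= e].
  have /compact_near_coveringP := @compact_norm_eq1 R U.
  apply => h h1 /=.
  have e20 : 0 < e / 2 by rewrite divr_gt0.
  have /cvgrPdist_lt/(_ _ e20) fh := fD h.
  have /cvgrPdist_lt/(_ _ e20) Dh := Dcont h.
  have [[/= P Q] [Pp Qh] PQ] := fh.
  exists (Q `&` [set u | `|D h - D u| < e / 2], P).
    by split=> //; exact: filterI.
  move=> [u p] [[/= Qu Du] Pp']; have /= pu := PQ (p, u) (conj Pp' Qu).
  rewrite -(subrKA (D h)) (splitr e).
  by apply: (le_trans (ler_normD _ _)); rewrite lerD// ltW// distrC.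
case=> -[/= P Q] [/nbhs_ballP[d1 /= d10 dP] /nbhs_ballP[d2 /= d20 dQ]] PQ.
(* The half makes the time [|b - a|] smaller than [d1], by the triangle inequality through [x]. *)
exists (Num.min (d1 / 2) d2); first by rewrite lt_min d20 divr_gt0.
move=> a b; rewrite !lt_min => /andP[a1 a2] /andP[b1 _].
have [->|ab] := eqVneq b a; first by rewrite !subrr linear0 subrr !normr0 mulr0.
have ab0 : 0 < `|b - a| by rewrite normr_gt0 subr_eq0.
have Pab : P `|b - a|.
  apply: dP => //=; rewrite -ball_normE /= sub0r normrN normr_id.
  rewrite -(subrKA x) (splitr d1) (le_lt_trans (ler_normD _ _))// ltrD//.
  by rewrite distrC.
have Qa : Q a by apply: dQ; rewrite -ball_normE /= distrC.
have := PQ (`|b - a|, a) (conj Pab Qa) (`|b - a|^-1 *: (b - a)).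
rewrite /= normrZ normfV normr_id mulVf ?gt_eqF// => /(_ erefl).
rewrite scalerA mulfV ?gt_eqF// scale1r [a + _]addrC subrK linearZ /= -scalerBr.
by rewrite normrZ normfV normr_id ler_pdivrMl// mulrC.
Qed.

Lemma strict_frechet_hadamard {U V : normedModType R}
    (f : U -> V) (x : U) (D : {linear U -> V}) :
  continuous D -> strict_frechet_derivative f x D ->
  is_strict_hadamard_derivative f x D.
Proof.
move=> Dcont fD; split=> // h; apply/cvgrPdist_le => e e0.
have h1 : 0 < `|h| + 1 by rewrite ltr_wpDl.
(* Directions within 1 of [h] have norm at most [|h| + 1], so this tolerance costs [e / 2] on
   quotients; the other half pays for replacing [D u] by [D h]. *)
have [|d d0 dfD] := fD (e / 2 / (`|h| + 1)); first by rewrite !divr_gt0.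
have e20 : 0 < e / 2 by rewrite divr_gt0.
have /cvgrPdist_lt/(_ _ e20) Dh := Dcont h.
have d20 : 0 < d / 2 by rewrite divr_gt0.
exists ([set p | 0 < p.1 < d / 2 / (`|h| + 1) /\ `|p.2 - x| < d / 2],
  [set u | `|D h - D u| < e / 2 /\ `|h - u| < 1]).
  split=> /=.
    exists ([set t | 0 < t < d / 2 / (`|h| + 1)], [set y | `|y - x| < d / 2]) => //=.
    split; first by apply: nbhs_right0_lt; rewrite !divr_gt0.
    by apply/nbhs_ballP; exists (d / 2) => //= y; rewrite -ball_normE /= distrC.
  apply: filterI; first exact: Dh.
  by apply/nbhs_ballP; exists 1 => //= y; rewrite -ball_normE.
move=> [[t y] u] /= [[/andP[t0 td] yx] [Du hu]].
have u_le : `|u| <= `|h| + 1.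
  by rewrite -(subrK h u) addrC (le_trans (ler_normD _ _))// lerD2l distrC ltW.
have yd : `|y - x| < d by rewrite (lt_trans yx)// ltr_pdivrMr// ltr_pMr// ltr1n.
have yud : `|y + t *: u - x| < d.
  by apply: (ltr_norm_shift yx u_le h1); rewrite t0.
have yuy : y + t *: u - y = t *: u by rewrite addrC addKr.
have := dfD _ _ yd yud; rewrite yuy normrZ gtr0_norm// => fyu.
rewrite -(subrKA (D u)) (splitr e) (le_trans (ler_normD _ _))// lerD//.
  exact: ltW.
rewrite -(ler_pM2l t0) -{1}(gtr0_norm t0) -normrZ scalerBr scalerA.
rewrite mulfV ?gt_eqF// scale1r distrC -linearZ; apply: (le_trans fyu).
by rewrite mulrCA ler_pM2l// mulrAC ler_pdivrMr// ler_pM2l.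
Qed.

End StrictHadamardFrechet.

(** * Cones of locally parametrized sets *)

(** Let [A] be the set of times at which the bound holds. Its supremum belongs to [A] by the
    Lipschitz estimate; if it were less than [T], the hypothesis on small increments would yield a
    larger element of [A]. *)
Lemma dini_mean_value {R : realType} {V : normedModType R}
    (f : R -> V) (T C e : R) : 0 <= T -> 0 <= e ->
  (forall s t, 0 <= s <= T -> 0 <= t <= T -> `|f t - f s| <= C * `|t - s|) ->
  (forall t d, 0 <= t < T -> 0 < d ->
    exists2 s, 0 < s < d & `|f (t + s) - f t| <= e * s) ->
  `|f T - f 0| <= e * T.
Proof.
move=> T0 e0 f_lip f_dini.
pose A : set R := [set t | 0 <= t <= T /\ `|f t - f 0| <= e * t].
have A0 : A 0 by rewrite /A /= lexx T0 subrr normr0 mulr0.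
have A_ub : ubound A T by move=> t [/andP[]].
have supA : has_sup A by split; [exists 0|exists T].
have s_ge0 : 0 <= sup A by exact: (ub_le_sup supA.2 A0).
have s_leT : sup A <= T by apply: ge_sup => //; exists 0.
have sA : A (sup A).
  split; first by rewrite s_ge0.
  apply/ler_addgt0Pr => r r0.
  (* [C] carries no sign assumption, so a positive majorant is used as divisor. *)
  have C1 : 0 < `|C| + 1 by rewrite ltr_wpDl.
  have [t At st] := sup_adherent (divr_gt0 r0 C1) supA.
  have ts : t <= sup A by exact: (ub_le_sup supA.2 At).
  have [/andP[t0 tT] ft] := At.
  rewrite -(subrKA (f t)) (le_trans (ler_normD _ _))// addrC lerD//.
    by rewrite (le_trans ft)// ler_wpM2l.
  apply: (le_trans (f_lip _ _ _ _)); rewrite ?t0 ?s_ge0//.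
  rewrite ger0_norm ?subr_ge0//.
  apply: (@le_trans _ _ ((`|C| + 1) * (sup A - t))).
    by rewrite ler_wpM2r ?subr_ge0// (le_trans (ler_norm C))// lerDl.
  by rewrite mulrC -ler_pdivlMr// lerBlDr addrC -lerBlDr ltW.
have [sT|Ts] := ltP (sup A) T; last first.
  have sE : sup A = T by apply/eqP; rewrite eq_le s_leT.
  by case: sA; rewrite sE.
have sT0 : 0 < T - sup A by rewrite subr_gt0.
have [|t /andP[t0 tT] ft] := f_dini (sup A) (T - sup A) _ sT0.
  by rewrite s_ge0.
have : A (sup A + t).
  split; first by rewrite addr_ge0 ?(ltW t0)//= addrC -lerBrDr ltW.
  rewrite -(subrKA (f (sup A))) (le_trans (ler_normD _ _))// mulrDr addrC.
  by rewrite lerD//; case: sA.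
by move=> /(ub_le_sup supA.2); rewrite gerDl leNgt t0.
Qed.

(** The second clause asks for preimages close to [x0], so that estimates on [psi] valid only near
    [x0] apply to all points of [S] near [psi x0]. *)
Definition locally_parametrizes {R : realType} {X Z : normedModType R}
    (psi : X -> Z) (x0 : X) (S : set Z) : Prop :=
  (\forall x \near x0, S (psi x)) /\
  forall d : R, 0 < d -> \forall z \near psi x0,
    S z -> exists2 x, `|x - x0| < d & psi x = z.

Definition bilipschitz_near {R : realType} {X Z : normedModType R}
    (psi : X -> Z) (x0 : X) (c C : R) : Prop :=
  exists2 d : R, 0 < d & forall a b, `|a - x0| < d -> `|b - x0| < d ->
    c * `|b - a| <= `|psi b - psi a| <= C * `|b - a|.

Section LocalParametrization.
Context {R : realType} {X : normedModType R} {Z : normedVectType R}.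
Variables (psi : X -> Z) (x0 : X) (S : set Z) (c C : R).
Hypothesis S_psi : locally_parametrizes psi x0 S.
Hypotheses (c0 : 0 < c) (C0 : 0 < C).
Hypothesis psi_bilip : bilipschitz_near psi x0 c C.

Lemma parametrization_continuous : psi x @[x --> x0] --> psi x0.
Proof.
have [d d0 psiP] := psi_bilip.
apply/cvgrPdist_lt => e e0; apply/nbhs_ballP.
exists (Num.min d (e / C)); first by rewrite /= lt_min d0 divr_gt0.
move=> x; rewrite -ball_normE /= lt_min => /andP[xd xe].
have /andP[_ h] : c * `|x0 - x| <= `|psi x0 - psi x| <= C * `|x0 - x|.
  by apply: psiP; rewrite ?subrr ?normr0// distrC.
by apply: (le_lt_trans h); rewrite mulrC -ltr_pdivlMr.
Qed.

(** The quotients of [psi] at [x] along [u] are bounded by the Lipschitz estimate, so they have a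
    cluster point [k] as the time tends to [0]. It lies in the cone since [psi (x + t *: u)] is in
    [S] for small [t]. *)
Lemma contingent_cone_quotient : exists2 d1 : R, 0 < d1 & forall x u,
  `|x - x0| < d1 -> exists2 k, contingent_cone S (psi x) k &
    forall e d : R, 0 < e -> 0 < d -> exists2 t, 0 < t < d &
      `|t^-1 *: (psi (x + t *: u) - psi x) - k| < e.
Proof.
have [d d0 psiP] := psi_bilip.
have [/nbhs_ballP[d' /= d'0 S_near] _] := S_psi.
pose r := Num.min d d'; have r0 : 0 < r by rewrite lt_min d0.
exists (r / 2); first exact: divr_gt0.
move=> x u xr.
have xd : `|x - x0| < d.
  apply: (lt_le_trans xr).
  apply: (@le_trans _ _ r); last by rewrite ge_min lexx.
  by rewrite ler_pdivrMr// ler_pMr// ler1n.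
have u1 : 0 < `|u| + 1 by rewrite ltr_wpDl.
pose r' := r / 2 / (`|u| + 1); have r'0 : 0 < r' by rewrite !divr_gt0.
have xtu t : 0 < t < r' -> `|x + t *: u - x0| < r.
  by move=> tr; apply: (ltr_norm_shift xr _ u1) => //; rewrite lerDl.
pose q (t : R) := t^-1 *: (psi (x + t *: u) - psi x).
have q_le : \forall t \near 0^'+, `|q t| <= C * `|u|.
  apply: filterS (nbhs_right0_lt r'0) => t tr.
  have /andP[t0 _] := tr; have := xtu _ tr; rewrite lt_min => /andP[xtd _].
  have /andP[_] := psiP _ _ xd xtd.
  have -> : x + t *: u - x = t *: u by rewrite addrC addKr.
  by rewrite /q !normrZ normfV (gtr0_norm t0) ler_pdivrMl// mulrCA.
have [k [_ k_cl]] := @compact_norm_le R Z (C * `|u|) (q @ 0^'+) _ q_le.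
have near_k e d1 : 0 < e -> 0 < d1 -> exists2 t, 0 < t < d1 & `|q t - k| < e.
  move=> e0 d10.
  (* Testing the cluster point on images of short time intervals recovers an actual time [t]. *)
  have Fd1 : (q @ 0^'+) (q @` [set t | 0 < t < d1]).
    by apply: filterS (nbhs_right0_lt d10) => t td; exists t.
  have [_ [[t td <-]]] := k_cl _ _ Fd1 (nbhsx_ballx k e e0).
  by rewrite -ball_normE /= distrC => qk; exists t.
exists k => //; apply/contingent_coneP => e d1 e0 d10.
have [|t tP tk] := near_k e (Num.min d1 r') e0; first by rewrite lt_min d10.
move: tP; rewrite lt_min => /and3P[t0 td1 tr'].
exists t; first by rewrite t0.
exists (psi (x + t *: u)) => //; apply: S_near; rewrite -ball_normE /= distrC.
have := xtu t; rewrite t0 tr' => /(_ isT); rewrite lt_min => /andP[_]; exact.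
Qed.

(** A point [s] of [S] realizing [k] at time [t] is within [t * (|k| + e)] of [psi x]. For small [t]
    it is close enough to [psi x0] to be some [psi y] with [y] near [x0]. *)
Lemma contingent_cone_preimage (d : R) : 0 < d ->
  exists2 d1 : R, 0 < d1 & forall x k, `|x - x0| < d1 ->
    contingent_cone S (psi x) k ->
    forall e r : R, 0 < e -> 0 < r -> exists2 t, 0 < t < r &
      exists2 y, `|y - x0| < d & `|t^-1 *: (psi y - psi x) - k| < e.
Proof.
move=> d0; have [_ /(_ d d0)/nbhs_ballP[b /= b0 bS]] := S_psi.
have b20 : 0 < b / 2 by exact: divr_gt0.
have /cvgrPdist_lt/(_ _ b20)/nbhs_ballP[d1 /= d10 psi_b] :=
  parametrization_continuous.
exists d1 => // x k xd1 /contingent_coneP Kk e r e0 r0.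
have ke0 : 0 < `|k| + e by rewrite ltr_wpDl.
have [|t] := Kk e (Num.min r (b / 2 / (`|k| + e))) e0.
  by rewrite lt_min r0 divr_gt0.
rewrite lt_min => /and3P[t0 tr tb] [s Ss sk].
exists t; first by rewrite t0.
have s_near : `|s - psi x| < b / 2.
  move: tb; rewrite ltr_pdivlMr//; apply: le_lt_trans.
  rewrite -ler_pdivrMl// -{1}(gtr0_norm t0) -normfV -normrZ.
  rewrite -[leLHS](subrK `|k|) addrC lerD2l.
  by apply: le_trans (ltW sk); exact: lerB_dist.
have [||y yd ys] := bS s.
- rewrite -ball_normE /= -(subrKA (psi x)) (splitr b).
  rewrite (le_lt_trans (ler_normD _ _))// ltrD//; last by rewrite distrC.
  by apply: psi_b; rewrite -ball_normE /= distrC.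
- exact: Ss.
by exists y => //; rewrite ys.
Qed.

End LocalParametrization.

(** * Cones under a strictly differentiable parametrization *)

Section StrictlyDifferentiableParametrization.
Context {R : realType} {X Z : normedVectType R}.
Variables (psi : X -> Z) (x0 : X) (S : set Z) (c C : R) (L : {linear X -> Z}).
Hypothesis S_psi : locally_parametrizes psi x0 S.
Hypotheses (c0 : 0 < c) (C0 : 0 < C).
Hypothesis psi_bilip : bilipschitz_near psi x0 c C.
Hypothesis L_inj : forall v, L v = 0 -> v = 0.
Hypothesis psi_diff : strict_frechet_derivative psi x0 L.

(** Near [h] there are quotients of [psi], and these are close to values [L u] with [u] bounded by
    the lower Lipschitz estimate. So [h] is in the closure of the range, which is closed. *)
Let cone_limsup_sub_range :
  set_limsup (contingent_cone S) (within S (nbhs (psi x0))) `<=` range L.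
Proof.
move=> h h_limsup; apply: range_injective_linear_closed => //.
move=> U /nbhs_ballP[e /= e0 hU].
(* The total error is [2 * eta] from [h] to the quotient, plus [eta * |u|] from the quotient to
   [L u], where [|u|] is at most [(|h| + 2) / c]. *)
pose K := 2 + (`|h| + 2) / c.
have K0 : 0 < K by rewrite ltr_pwDl// divr_ge0 ?addr_ge0// ltW.
pose eta := Num.min 1 (e / (K + 1)).
have K10 : 0 < K + 1 by rewrite addr_gt0.
have eta0 : 0 < eta by rewrite lt_min ltr01 divr_gt0.
have eta1 : eta <= 1 by rewrite ge_min lexx.
have etaK : eta * K < e.
  apply: (@lt_le_trans _ _ (eta * (K + 1))); first by rewrite ltr_pM2l// ltrDl.
  by rewrite -ler_pdivlMr// ge_min lexx orbT.
have [dl dl0 psi_l] := psi_bilip.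
have [ds ds0 psi_s] := psi_diff eta eta0.
pose d := Num.min dl ds; have d0 : 0 < d by rewrite lt_min dl0.
have [d1 d10 cone_d] :=
  contingent_cone_preimage _ _ _ _ _ S_psi C0 psi_bilip d d0.
pose d2 := Num.min d d1; have d20 : 0 < d2 by rewrite lt_min d0.
have [_ /(_ d2 d20) S_near] := S_psi.
move/set_limsupP : h_limsup.
move=> /(_ eta [set z | exists2 x, `|x - x0| < d2 & psi x = z] eta0 S_near).
move=> [_ [x xd2 <-] [k Kk kh]].
move: xd2; rewrite !lt_min => /andP[/andP[xdl xds] xd1].
have [t /andP[t0 _] [y yd yk]] := cone_d x k xd1 Kk eta 1 eta0 ltr01.
move: yd; rewrite lt_min => /andP[ydl yds].
pose u := t^-1 *: (y - x).
exists (L u); split; first by exists u.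
apply: hU; rewrite -ball_normE /= distrC; apply: le_lt_trans etaK.
pose q := t^-1 *: (psi y - psi x).
have qh : `|q - h| <= eta + eta.
  by rewrite -(subrKA k) (le_trans (ler_normD _ _))// lerD ?ltW.
have normt (V : normedModType R) (v : V) : `|t^-1 *: v| = t^-1 * `|v|.
  by rewrite normrZ normfV gtr0_norm.
have qL : `|q - L u| <= eta * `|u|.
  rewrite /u linearZ /= -scalerBr !normt mulrCA ler_pM2l ?invr_gt0//.
  exact: psi_s.
have u_le : `|u| <= (`|h| + 2) / c.
  rewrite ler_pdivlMr// mulrC; apply: (@le_trans _ _ `|q|).
    rewrite !normt mulrCA ler_pM2l ?invr_gt0//.
    by have /andP[] := psi_l _ _ xdl ydl.
  rewrite -(subrK h q) addrC (le_trans (ler_normD _ _))// lerD2l.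
  by apply: (le_trans qh); rewrite -[leRHS]/(1 + 1) lerD.
rewrite -(subrKA q) (le_trans (ler_normD _ _))// /K mulrDr addrC lerD//.
  by rewrite mulr_natr mulr2n.
by rewrite distrC (le_trans qL)// ler_wpM2l// ltW.
Qed.

(** At each [z = psi x] near [psi x0], a cluster point of the quotients along [u] lies in the cone
    and is close to [L u] by strict differentiability. *)
Let range_sub_cone_liminf :
  range L `<=` set_liminf (contingent_cone S) (within S (nbhs (psi x0))).
Proof.
move=> _ [u _ <-]; apply/set_liminfP => e e0.
have u1 : 0 < `|u| + 1 by rewrite ltr_wpDl.
have e20 : 0 < e / 2 by rewrite divr_gt0.
have [|d d0 psi_s] := psi_diff (e / 2 / (`|u| + 1)); first by rewrite divr_gt0.
have [d1 d10 quot] := contingent_cone_quotient _ _ _ _ _ S_psi psi_bilip.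
have d20 : 0 < d / 2 by rewrite divr_gt0.
have d'0 : 0 < Num.min d1 (d / 2) by rewrite lt_min d10.
have [_ /(_ _ d'0)] := S_psi.
apply: filterS => z zS /zS[x + <-]; rewrite lt_min => /andP[xd1 xd].
have [k Kk qk] := quot x u xd1; exists k => //.
have [|t tP tk] := qk (e / 2) (d / 2 / (`|u| + 1)) e20.
  by rewrite divr_gt0.
have t0 : 0 < t by case/andP: tP.
have xtu : `|x + t *: u - x0| < d.
  by apply: (ltr_norm_shift xd _ u1 tP); rewrite lerDl.
have xd' : `|x - x0| < d.
  by rewrite (lt_trans xd)// ltr_pdivrMr// ltr_pMr// ltr1n.
have := psi_s _ _ xd' xtu.
have -> : x + t *: u - x = t *: u by rewrite addrC addKr.
rewrite normrZ gtr0_norm// => psi_u.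
rewrite -(subrKA (t^-1 *: (psi (x + t *: u) - psi x))) (splitr e).
rewrite (le_lt_trans (ler_normD _ _))// ltr_leD//; first by rewrite distrC.
rewrite -(ler_pM2l t0) -{1}(gtr0_norm t0) -normrZ scalerBr scalerA.
rewrite mulfV ?gt_eqF// scale1r -linearZ; apply: (le_trans psi_u).
by rewrite mulrCA ler_pM2l// mulrAC ler_pdivrMr// ler_pM2l// lerDl.
Qed.

(** Cyclic inclusions: the cone lies in the upper limit, which lies in the range of [L], which lies
    in the lower limit, which lies in the cone. All four sets coincide. *)
Lemma strict_derivative_cone : contingent_cone S (psi x0) = range L /\
  set_continuous_at_wrt S (contingent_cone S) (psi x0).
Proof.
have Sx0 : S (psi x0) by case: S_psi => /nbhs_singleton.
have cone_sub := subset_set_limsup_within _ _ (contingent_cone S) Sx0.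
have liminf_sub := set_liminf_within_sub_cone _ _ Sx0.
have coneE : contingent_cone S (psi x0) = range L.
  apply/seteqP; split; first exact: subset_trans cone_sub cone_limsup_sub_range.
  exact: subset_trans range_sub_cone_liminf liminf_sub.
split=> //; split; apply/seteqP; split=> //; rewrite coneE//.
Qed.

End StrictlyDifferentiableParametrization.

(** * Uniform upper semicontinuity of the contingent cone *)

Section UpperSemicontinuity.
Context {R : realType} {Z : normedVectType R}.

Lemma contingent_cone0 (S : set Z) (z : Z) : S z -> contingent_cone S z 0.
Proof.
move=> Sz; apply/contingent_coneP => e d e0 d0; exists (d / 2).
  by rewrite divr_gt0//= ltr_pdivrMr// ltr_pMr// ltr1n.
by exists z => //; rewrite subrr scaler0 subr0 normr0.
Qed.

(** On the unit sphere, a [k] in the cone at [z0] serves as [h] for its neighbours; any other [k] is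
    outside the upper limit, so cones at nearby points avoid a ball around it. Compactness makes
    this uniform, and homogeneity gives the relative error. *)
Lemma contingent_cone_upper_semicontinuous (S : set Z) (z0 : Z) : S z0 ->
  set_limsup (contingent_cone S) (within S (nbhs z0))
    `<=` contingent_cone S z0 ->
  forall e : R, 0 < e -> \forall z \near z0, S z ->
    forall k, contingent_cone S z k ->
      exists2 h, contingent_cone S z0 h & `|k - h| <= e * `|k|.
Proof.
move=> Sz0 limsup_sub e e0.
pose P (z k : Z) := contingent_cone S z k ->
  exists2 h, contingent_cone S z0 h & `|k - h| <= e.
have : \forall z \near within S (nbhs z0), [set k : Z | `|k| = 1] `<=` P z.
  have /compact_near_coveringP := @compact_norm_eq1 R Z; apply => k k1.
  have [Ek|nEk] := pselect (contingent_cone S z0 k).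
    exists (ball k e, setT) => /=.
      by split; [exact: nbhsx_ballx|exact: filterT].
    move=> [k' z] /= [kk' _] _; exists k => //.
    by move: kk'; rewrite -ball_normE /= distrC => /ltW.
  have : ~ set_limsup (contingent_cone S) (within S (nbhs z0)) k.
    by move/limsup_sub.
  move/set_limsupP/existsNP.
  move=> [r /existsNP[B /not_implyP[r0 /not_implyP[SB nB]]]].
  exists (ball k r, B) => /=; first by split=> //; exact: nbhsx_ballx.
  move=> [k' z] /= [kk' Bz] Kk'; exfalso; apply: nB; exists z => //.
  by exists k' => //; move: kk'; rewrite -ball_normE /= distrC.
apply: (@filterS _ (nbhs z0)) => z zP Sz k Kk.
have [->|k_neq0] := eqVneq k 0.
  exists 0; first exact: contingent_cone0.
  by rewrite subr0 !normr0 mulr0.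
have k0 : 0 < `|k| by rewrite normr_gt0.
have [||h Eh kh] := zP Sz (`|k|^-1 *: k).
- by rewrite /= normrZ normfV normr_id mulVf// gt_eqF.
- by apply: contingent_coneZ => //; rewrite invr_gt0.
exists (`|k| *: h); first exact: contingent_coneZ.
rewrite -{1}(scale1r k) -(mulfV (lt0r_neq0 k0)) -scalerA -scalerBr.
by rewrite normrZ normr_id mulrC ler_pM2r.
Qed.

End UpperSemicontinuity.

(** Transversality to the vertical space makes [fstL], the first component of [D^-1 L], injective.
    Undoing it and then taking the second component gives [A]. *)
Lemma linear_subspace_is_graph {R : fieldType} {X : vectType R}
    {Y Z : lmodType R} (D : {linear (X * Y)%type -> Z}) (L : {linear X -> Z}) :
  bijective D -> (forall w v, L w = D (0, v) -> w = 0) ->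
  exists A : {linear X -> Y}, forall w, exists u, L w = D (u, A u).
Proof.
move=> [Dinv DK DinvK] L_transversal.
have Dinv_linear : linear Dinv by exact: can2_linear DK DinvK.
pose Di : {linear Z -> (X * Y)%type} :=
  HB.pack Dinv (GRing.isLinear.Build _ _ _ _ Dinv Dinv_linear).
pose fstL : {linear X -> X} := fst \o Di \o L.
pose sndL : {linear X -> Y} := snd \o Di \o L.
pose N := linfun fstL.
have LE w : L w = D (fstL w, sndL w).
  by rewrite /fstL /sndL /= -surjective_pairing DinvK.
have N_inj : lker N == 0%VS.
  apply/lker0P => a b; rewrite !lfunE => ab.
  apply/eqP; rewrite -subr_eq0; apply/eqP.
  apply: (L_transversal _ (sndL (a - b))).
  by rewrite LE linearB ab subrr.
exists (sndL \o (N^-1)%VF : {linear X -> Y}) => w; exists (N w).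
by rewrite LE /= lker0_lfunK// lfunE.
Qed.

(** * Images of graphs *)

Section ProductNormedVector.
Context {R : realType} {X Y : normedVectType R}.

(** This equips the product, under its maximum norm, with the joint structure required by the finite
    dimensional lemmas. *)
HB.instance Definition _ := NormedModule.on (X * Y)%type.

Lemma norm_pair_lt (u : X) (v : Y) (r : R) :
  `|u| < r -> `|v| < r -> `|(u, v)| < r.
Proof. by move=> ur vr; rewrite prod_normE /= gt_max ur. Qed.

Lemma norm_pair_le (u : X) (v : Y) (r : R) :
  `|u| <= r -> `|v| <= r -> `|(u, v)| <= r.
Proof. by move=> ur vr; rewrite prod_normE /= ge_max ur. Qed.

Lemma norm_fst_le (u : X) (v : Y) : `|u| <= `|(u, v)|.
Proof. by rewrite prod_normE /= le_max lexx. Qed.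

Lemma norm_snd_le (u : X) (v : Y) : `|v| <= `|(u, v)|.
Proof. by rewrite prod_normE /= le_max lexx orbT. Qed.

End ProductNormedVector.

Lemma locally_lipschitz_aroundP {R : realType} {X Y : normedModType R}
    (g : X -> Y) (x0 : X) : locally_lipschitz_around g x0 ->
  exists2 M : R, 0 < M & exists2 d : R, 0 < d &
    forall a b, `|a - x0| < d -> `|b - x0| < d ->
      `|g b - g a| <= M * `|b - a|.
Proof.
move=> [U /nbhs_ballP[d /= d0 dU] /pinfty_ex_gt0[M M0 gM]].
exists M => //; exists d => // a b ad bd.
apply: (gM (b, a)); split => /=; apply: dU; rewrite -ball_normE /= distrC //.
Qed.

Section GraphParametrization.
Context {R : realType} {X Y Z : normedVectType R}.
Variables (g : X -> Y) (x0 : X) (phi : (X * Y)%type -> Z).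
Variable D : {linear (X * Y)%type -> Z}.
Variables (M c C : R).
Hypotheses (M0 : 0 < M) (c0 : 0 < c) (C0 : 0 < C).
Hypothesis g_lip : exists2 d : R, 0 < d &
  forall a b, `|a - x0| < d -> `|b - x0| < d -> `|g b - g a| <= M * `|b - a|.
Hypothesis phi_diff : strict_frechet_derivative phi (x0, g x0) D.
Hypothesis D_ge : forall q, c * `|q| <= `|D q|.
Hypothesis D_le : forall q, `|D q| <= C * `|q|.

Let psi x := phi (x, g x).

Let M1_gt0 : 0 < M + 1. Proof. by rewrite addr_gt0. Qed.

(** An increment of the graph has norm at most [(M + 1) * |b - a|], hence the tolerance
    [e / (M + 1)] for [phi]. *)
Lemma graph_strict_frechet (e : R) : 0 < e -> exists2 d : R, 0 < d &
  forall a b, `|a - x0| < d -> `|b - x0| < d ->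
    `|psi b - psi a - D (b - a, g b - g a)| <= e * `|b - a|.
Proof.
move=> e0; have [d d0 gM] := g_lip.
have [|d1 d10 phiD] := phi_diff (e / (M + 1)); first exact: divr_gt0.
pose r := Num.min d (d1 / (M + 1)).
have r0 : 0 < r by rewrite lt_min d0 divr_gt0.
have near_graph x : `|x - x0| < r -> `|(x, g x) - (x0, g x0)| < d1.
  rewrite lt_min ltr_pdivlMr// => /andP[xd xd1].
  apply: norm_pair_lt.
    by apply: le_lt_trans xd1; rewrite ler_peMr// lerDr ltW.
  apply: le_lt_trans xd1; apply: (@le_trans _ _ (M * `|x - x0|)).
    by apply: gM; rewrite ?subrr ?normr0.
  by rewrite mulrC ler_wpM2l// lerDl.
exists r => // a b ar br.
apply: (le_trans (phiD _ _ (near_graph _ ar) (near_graph _ br))).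
rewrite mulrAC ler_pdivrMr// -mulrA ler_pM2l//.
apply: norm_pair_le; first by rewrite ler_peMr// lerDr ltW.
move: ar br; rewrite !lt_min => /andP[ad _] /andP[bd _].
apply: (le_trans (gM _ _ ad bd)).
by rewrite mulrC ler_wpM2l// lerDl.
Qed.

(** The increment [q] of the graph has norm between [|b - a|] and [(M + 1) * |b - a|], and [D]
    distorts norms by factors between [c] and [C]. The linearization error is kept below both
    [c / 2] and [1] times [|b - a|]. *)
Lemma graph_bilipschitz : bilipschitz_near psi x0 (c / 2) (C * (M + 1) + 1).
Proof.
have [d d0 gM] := g_lip.
pose e := Num.min 1 (c / 2).
have e0 : 0 < e by rewrite lt_min ltr01 divr_gt0.
have [d1 d10 psiD] := graph_strict_frechet e e0.
exists (Num.min d d1); first by rewrite lt_min d0.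
move=> a b; rewrite !lt_min => /andP[ad ad1] /andP[bd bd1].
have pab := psiD _ _ ad1 bd1.
have gab := gM _ _ ad bd.
set w := `|b - a| in pab gab *.
have w0 : 0 <= w by exact: normr_ge0.
set q := (b - a, g b - g a) in pab *.
have qw : w <= `|q| by exact: norm_fst_le.
have qM : `|q| <= (M + 1) * w.
  apply: norm_pair_le; first by rewrite ler_peMl// lerDr ltW.
  by rewrite (le_trans gab)// ler_wpM2r// lerDl.
apply/andP; split.
  have : e * w <= c / 2 * w by rewrite ler_wpM2r// /e ge_min lexx orbT.
  have : c * w <= c * `|q| by rewrite ler_pM2l.
  have := D_ge q.
  have : `|D q| <= `|psi b - psi a| + `|psi b - psi a - D q|.
    by rewrite -{1}(subKr (psi b - psi a) (D q)) ler_normB.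
  by lra.
have : e * w <= 1 * w by rewrite ler_wpM2r// /e ge_min lexx.
have : C * `|q| <= C * ((M + 1) * w) by rewrite ler_pM2l.
have := D_le q.
have : `|psi b - psi a| <= `|D q| + `|psi b - psi a - D q|.
  by rewrite -{1}(subrK (D q) (psi b - psi a)) addrC ler_normD.
by lra.
Qed.

(** Replacing [g b - g a] by [A (b - a)] inside [D] costs at most [C] times the error of [g]. *)
Lemma graph_strict_derivative (A : X -> Y) :
  strict_frechet_derivative g x0 A ->
  strict_frechet_derivative psi x0 (fun u => D (u, A u)).
Proof.
move=> gA e e0.
have [|d d0 psiD] := graph_strict_frechet (e / 2); first exact: divr_gt0.
have [|d1 d10 gD] := gA (e / 2 / C); first by rewrite !divr_gt0.
exists (Num.min d d1); first by rewrite lt_min d0.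
move=> a b; rewrite !lt_min => /andP[ad ad1] /andP[bd bd1].
have h1 := psiD _ _ ad bd; have h2 := gD _ _ ad1 bd1.
rewrite -(subrKA (D (b - a, g b - g a))) (le_trans (ler_normD _ _))//.
rewrite [e in leRHS]splitr mulrDl lerD// -linearB.
apply: (le_trans (D_le _)); rewrite -ler_pdivlMl// mulrA (mulrC C^-1).
apply: norm_pair_le => //=.
by rewrite subrr normr0 mulr_ge0// !divr_ge0// ltW.
Qed.

Variable S : set Z.
Hypothesis S_psi : locally_parametrizes psi x0 S.

Let C'0 : 0 < C * (M + 1) + 1. Proof. by rewrite addr_gt0// mulr_gt0. Qed.

(** The pair [(u, v)] is a limit of rescaled graph increments [(u', v')], which satisfy
    [|v'| <= M * |u'|]. For [u = 0] this excludes nonzero vertical vectors. *)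
Lemma graph_cone_norm_le (u : X) (v : Y) :
  contingent_cone S (psi x0) (D (u, v)) -> `|v| <= M * `|u|.
Proof.
move=> Kuv; apply/ler_addgt0Pr => r r0.
have [dl dl0 gM] := g_lip.
have [db db0 psi_b] := graph_bilipschitz.
set h := D (u, v) in Kuv.
(* [e * K] bounds the distance from [(u', v')] to [(u, v)]: both the error of the quotient and the
   linearization error are divided by the lower bound [c] of [D]. *)
pose K := (1 + (`|h| + 1) / (c / 2)) / c.
have c20 : 0 < c / 2 by exact: divr_gt0.
have h1 : 0 < `|h| + 1 by rewrite ltr_wpDl.
have K0 : 0 < K by rewrite divr_gt0// addr_gt0// divr_gt0.
have MK0 : 0 < (M + 1) * K by exact: mulr_gt0.
pose e := Num.min 1 (r / ((M + 1) * K)).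
have e0 : 0 < e by rewrite lt_min ltr01 divr_gt0.
have e1 : e <= 1 by rewrite ge_min lexx.
have eK : e * ((M + 1) * K) <= r.
  by rewrite -ler_pdivlMr// ge_min lexx orbT.
have [ds ds0 psiD] := graph_strict_frechet e e0.
pose d := Num.min dl (Num.min db ds).
have d0 : 0 < d by rewrite !lt_min dl0 db0.
have [d1 d10 cone_d] :=
  contingent_cone_preimage _ _ _ _ _ S_psi C'0 graph_bilipschitz d d0.
have [|t /andP[t0 _] [y yd yh]] := cone_d x0 h _ Kuv e 1 e0 ltr01.
  by rewrite subrr normr0.
move: yd; rewrite !lt_min => /and3P[ydl ydb yds].
have x0d d' : 0 < d' -> `|x0 - x0| < d' by rewrite subrr normr0.
have normt (V : normedModType R) (w : V) : `|t^-1 *: w| = t^-1 * `|w|.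
  by rewrite normrZ normfV gtr0_norm.
set q := t^-1 *: (psi y - psi x0) in yh.
pose u' := t^-1 *: (y - x0); pose v' := t^-1 *: (g y - g x0).
have v'u' : `|v'| <= M * `|u'|.
  by rewrite !normt mulrCA ler_pM2l ?invr_gt0//; exact: gM (x0d _ _) ydl.
have u'_le : `|u'| <= (`|h| + 1) / (c / 2).
  rewrite ler_pdivlMr// mulrC; apply: (@le_trans _ _ `|q|).
    rewrite !normt mulrCA ler_pM2l ?invr_gt0//.
    by have /andP[] := psi_b _ _ (x0d _ db0) ydb.
  rewrite -(subrK h q) addrC (le_trans (ler_normD _ _))// lerD2l.
  exact: le_trans (ltW yh) e1.
have qD : `|q - D (u', v')| <= e * `|u'|.
  have -> : (u', v') = t^-1 *: (y - x0, g y - g x0) by [].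
  rewrite linearZ /= -scalerBr !normt mulrCA ler_pM2l ?invr_gt0//.
  exact: psiD (x0d _ _) yds.
have : `|(u' - u, v' - v)| <= e * K.
  have -> : (u' - u, v' - v) = (u', v') - (u, v) by [].
  rewrite mulrA ler_pdivlMr// mulrC (le_trans (D_ge _))// linearB -/h.
  rewrite -(subrKA q) (le_trans (ler_normD _ _))// mulrDr mulr1 addrC.
  rewrite lerD//; first exact: ltW.
  by rewrite distrC (le_trans qD)// ler_pM2l.
move=> uv_le.
have hu := le_trans (norm_fst_le _ _) uv_le.
have hv := le_trans (norm_snd_le _ _) uv_le.
have : `|v| <= `|v'| + `|v' - v|.
  by rewrite -{1}(subKr v' v) ler_normB.
have : `|u'| <= `|u| + `|u' - u|.
  by rewrite -{1}(subrK u u') addrC ler_normD.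
move=> hu'; have := ler_wpM2l (ltW M0) (le_trans hu' (lerD (lexx _) hu)).
rewrite mulrDr; have eKE : e * ((M + 1) * K) = M * (e * K) + e * K by ring.
move: eK; rewrite eKE; move: v'u' hv; set m := M * (e * K); set n := e * K; lra.
Qed.

(** The mean value inequality is applied to [g - A] along the segment from [a] to [b]. At each of
    its points, some quotient of [psi] along [w] is close to a cone element at [psi x0], that is, to
    some [D (u, A u)]; so [(w, v)] is close to [(u, A u)], and [v] to [A w]. *)
Lemma cone_continuous_strict_derivative (A : {linear X -> Y}) :
  set_limsup (contingent_cone S) (within S (nbhs (psi x0)))
    `<=` contingent_cone S (psi x0) ->
  (forall h, contingent_cone S (psi x0) h -> exists u, h = D (u, A u)) ->
  strict_frechet_derivative g x0 A.
Proof.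
move=> limsup_sub cone_graph e e0.
have Sx0 : S (psi x0) by case: S_psi => /nbhs_singleton.
have [CA CA0 A_le] := linear_norm_le A.
pose Cb := C * (M + 1) + 1.
have [db db0 psi_b] := graph_bilipschitz.
have [dl dl0 gM] := g_lip.
(* Two errors [eta * |w|] and one [eta * (1 + Cb) * |w|] add up to [3 + Cb]; [D_ge] divides by [c],
   and [1 + CA] accounts for [v - A w = (v - A u) - A (w - u)]. *)
pose K := (1 + CA) * ((3 + Cb) / c).
have K0 : 0 < K by rewrite mulr_gt0 ?divr_gt0// addr_gt0.
pose eta := Num.min 1 (e / K).
have eta0 : 0 < eta by rewrite lt_min ltr01 divr_gt0.
have eta1 : eta <= 1 by rewrite ge_min lexx.
have etaK : eta * K <= e by rewrite -ler_pdivlMr// ge_min lexx orbT.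
have [ds ds0 psiD] := graph_strict_frechet eta eta0.
have [dq dq0 quot] :=
  contingent_cone_quotient _ _ _ _ _ S_psi graph_bilipschitz.
have psi_cont := parametrization_continuous _ _ _ _ C'0 graph_bilipschitz.
have usc := contingent_cone_upper_semicontinuous _ _ Sx0 limsup_sub _ eta0.
have /nbhs_ballP[du /= du0 cone_near] : \forall x \near x0, S (psi x) /\
    forall k, contingent_cone S (psi x) k ->
      exists2 h, contingent_cone S (psi x0) h & `|k - h| <= eta * `|k|.
  have := psi_cont _ usc; case: (S_psi) => + _.
  by apply: filterS2 => x Sx /(_ Sx).
pose d := Num.min (Num.min db dl) (Num.min ds (Num.min dq du)).
have d0 : 0 < d by rewrite !lt_min db0 dl0 ds0 dq0.
exists d => // a b ad bd.
have [->|ab] := eqVneq b a; first by rewrite !subrr linear0 subrr !normr0 mulr0.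
set w := b - a.
have w0 : 0 < `|w| by rewrite normr_gt0 subr_eq0.
have segment_ball s : 0 <= s <= 1 -> `|a + s *: w - x0| < d.
  move=> /andP[s0 s1].
  have -> : a + s *: w - x0 = (1 - s) *: (a - x0) + s *: (b - x0).
    have -> : w = (b - x0) - (a - x0) by rewrite opprB addrA subrK.
    rewrite scalerBr scalerBl scale1r addrAC -[in RHS]addrA.
    by rewrite [in RHS](addrC (- _)).
  apply: le_lt_trans (_ : Num.max `|a - x0| `|b - x0| < d); last first.
    by rewrite gt_max ad.
  rewrite (le_trans (ler_normD _ _))// !normrZ !ger0_norm ?subr_ge0//.
  set m := Num.max _ _; have -> : m = (1 - s) * m + s * m by ring.
  by rewrite lerD// ler_wpM2l ?subr_ge0// le_max lexx ?orbT.
pose f (s : R) := g (a + s *: w) - s *: A w.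
have -> : g b - g a - A w = f 1 - f 0.
  by rewrite /f !scale1r !scale0r subr0 addr0 [a + w]addrC subrK addrAC.
rewrite -[leRHS]mulr1; apply: (dini_mean_value f 1 (M * `|w| + `|A w|)) => //.
- by rewrite mulr_ge0// ltW.
- move=> s t s01 t01.
  have := segment_ball _ s01; have := segment_ball _ t01.
  rewrite !lt_min => /andP[/andP[_ tl] _] /andP[/andP[_ sl] _].
  have := gM _ _ sl tl.
  have -> : a + t *: w - (a + s *: w) = (t - s) *: w.
    by rewrite opprD addrACA subrr add0r scalerBl.
  rewrite normrZ => g_st.
  have -> : f t - f s = (g (a + t *: w) - g (a + s *: w)) - (t - s) *: A w.
    by rewrite /f opprB scalerBl opprB addrACA [- _ + _]addrC addrACA.
  rewrite (le_trans (ler_normB _ _))// normrZ.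
  rewrite mulrDl lerD//; last by rewrite mulrC.
  by rewrite (le_trans g_st)// -mulrA (mulrC `|w|).
move=> t r /andP[t0 t1] r0.
pose x := a + t *: w.
have xd : `|x - x0| < d by apply: segment_ball; rewrite t0 ltW.
have := xd; rewrite !lt_min => /andP[/andP[xdb xdl] /and3P[xds xdq xdu]].
have [Sx x_usc] : S (psi x) /\ forall k, contingent_cone S (psi x) k ->
    exists2 h, contingent_cone S (psi x0) h & `|k - h| <= eta * `|k|.
  by apply: cone_near; rewrite -ball_normE /= distrC.
have [k Kk quot_k] := quot x w xdq.
(* The bound [1 - t] keeps [x + s *: w] on the segment, hence in the ball where all estimates
   hold. *)
have [||s] := quot_k (eta * `|w|) (Num.min r (1 - t)).
- exact: mulr_gt0.
- by rewrite lt_min r0 subr_gt0.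
rewrite lt_min => /and3P[s0 sr st] qk.
exists s; first by rewrite s0.
pose y := x + s *: w.
have yE : a + (t + s) *: w = y by rewrite scalerDl addrA.
have yx : y - x = s *: w by rewrite /y addrC addKr.
have yd : `|y - x0| < d.
  by rewrite -yE segment_ball// addr_ge0 ?(ltW s0)//= addrC -lerBrDr ltW.
have := yd; rewrite !lt_min => /andP[/andP[ydb _] /and3P[yds _ _]].
have norms (V : normedModType R) (v : V) : `|s^-1 *: v| = s^-1 * `|v|.
  by rewrite normrZ normfV gtr0_norm.
set q := s^-1 *: (psi y - psi x) in qk.
pose v := s^-1 *: (g y - g x).
have q_le : `|q| <= Cb * `|w|.
  rewrite norms ler_pdivrMl//; have /andP[_] := psi_b _ _ xdb ydb.
  by rewrite yx normrZ gtr0_norm// mulrCA.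
have qD : `|q - D (w, v)| <= eta * `|w|.
  have -> : (w, v) = s^-1 *: (y - x, g y - g x).
    by rewrite yx; congr pair; rewrite scalerA mulVf ?gt_eqF// scale1r.
  rewrite linearZ /= -scalerBr norms ler_pdivrMl//.
  by have := psiD _ _ xds yds; rewrite yx normrZ gtr0_norm// mulrCA.
have k_le : `|k| <= (1 + Cb) * `|w|.
  rewrite -(subrK q k) (le_trans (ler_normD _ _))// mulrDl lerD//.
  by rewrite distrC (le_trans (ltW qk))// ler_wpM2r.
have [h Kh kh] := x_usc k Kk; have [u hE] := cone_graph h Kh.
have wv_le : `|(w - u, v - A u)| <= eta * ((3 + Cb) / c) * `|w|.
  have -> : (w - u, v - A u) = (w, v) - (u, A u) by [].
  rewrite -mulrA mulrAC mulrA ler_pdivlMr// mulrC (le_trans (D_ge _))//.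
  rewrite linearB -hE -(subrKA q) (le_trans (ler_normD _ _))//.
  rewrite -(subrKA k q (- h)).
  have kh' := le_trans kh (ler_wpM2l (ltW eta0) k_le).
  have := ler_normD (q - k) (k - h).
  move: qD kh' qk; rewrite (distrC q (D _)).
  by lra.
have wu := le_trans (norm_fst_le _ _) wv_le.
have vAu := le_trans (norm_snd_le _ _) wv_le.
have fE : f (t + s) - f t = s *: (v - A w).
  rewrite /f yE -/x scalerBr scalerA mulfV ?gt_eqF// scale1r scalerDl.
  by rewrite opprD addrA addrAC opprB addrA subrK addrAC.
rewrite fE normrZ gtr0_norm// mulrC ler_pM2r//.
apply: (@le_trans _ _ (eta * K * `|w|)); last by rewrite ler_pM2r.
have -> : v - A w = (v - A u) - A (w - u).
  by rewrite [A (w - u)]linearB opprB subrKA.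
rewrite (le_trans (ler_normB _ _))//.
have := A_le (w - u); have := ler_wpM2l (ltW CA0) wu; rewrite /K.
by lra.
Qed.

End GraphParametrization.

(** Inside [Omega] the set [S] is the image of the graph. Localization, applied to the cylinder over
    the ball of radius [d] around [x0], supplies preimages near [x0]. *)
Lemma graph_image_parametrizes {R : realType} {X Y Z : normedModType R}
    (g : X -> Y) (x0 : X) (phi : (X * Y)%type -> Z) (S Omega : set Z) :
  phi (x, g x) @[x --> x0] --> phi (x0, g x0) ->
  open Omega -> Omega (phi (x0, g x0)) ->
  S `&` Omega = (phi @` graph_of g) `&` Omega ->
  image_localized_at phi (graph_of g) (x0, g x0) ->
  locally_parametrizes (fun x => phi (x, g x)) x0 S.
Proof.
move=> psi_cont Omega_open Omega0 S_graph phi_local.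
have Omega_nbhs : nbhs (phi (x0, g x0)) Omega by exact: open_nbhs_nbhs.
split.
  apply: (@filterS _ (nbhs x0) _ _ _ _ (psi_cont _ Omega_nbhs)) => x Ox.
  suff [] : (S `&` Omega) (phi (x, g x)) by [].
  by rewrite S_graph; split=> //; exists (x, g x) => //; exists x.
move=> d d0.
have : nbhs (x0, g x0) [set q : X * Y | `|q.1 - x0| < d].
  exists (ball x0 d, setT) => /=.
    by split; [exact: nbhsx_ballx|exact: filterT].
  by move=> [x y] /= [+ _]; rewrite -ball_normE /= distrC.
move=> /phi_local /(filterI Omega_nbhs); apply: filterS => z [Oz z_loc] Sz.
have [|_ [[x _ <-] xd] <-] := z_loc; last by exists x.
by suff [] : ((phi @` graph_of g) `&` Omega) z; rewrite -?S_graph.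
Qed.

(** * Strict differentiability of a Lipschitz map and continuity of the contingent cone *)

Theorem corollary5p4 (R : realType) (X Y Z : normedVectType R)
  (g : X -> Y) (xbar : X) (ybar : Y)
  (g_lip : locally_lipschitz_around g xbar)
  (ybarE : ybar = g xbar)
  (phi : (X * Y)%type -> Z) (Dphi : {linear (X * Y)%type -> Z})
  (phi_diff : is_strict_hadamard_derivative phi (xbar, ybar) Dphi)
  (Dphi_bij : bijective Dphi)
  (zbar : Z) (zbarE : zbar = phi (xbar, ybar))
  (S Omega : set Z) (S_closed : closed S)
  (Omega_open : open Omega) (zbar_Omega : Omega zbar)
  (S_graph : S `&` Omega = (phi @` graph_of g) `&` Omega)
  (phi_local : image_localized_at phi (graph_of g) (xbar, ybar)) :
  strictly_hadamard_differentiable g xbar <->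
  (set_continuous_at_wrt S (contingent_cone S) zbar /\
   is_subspace_isomorphic_to (contingent_cone S zbar) X).
Proof.
subst ybar zbar.
have [M M0 gM] := locally_lipschitz_aroundP _ _ g_lip.
have phiD := strict_hadamard_frechet _ _ _ phi_diff.
have D_inj q : Dphi q = 0 -> q = 0.
  by rewrite -(linear0 Dphi) => /(bij_inj Dphi_bij).
have [c c0 D_ge] := injective_linear_norm_ge Dphi D_inj.
have [C C0 D_le] := linear_norm_le Dphi.
have c20 : 0 < c / 2 by exact: divr_gt0.
have C'0 : 0 < C * (M + 1) + 1 by rewrite addr_gt0// mulr_gt0// addr_gt0.
have bilip := graph_bilipschitz _ _ _ _ _ _ _ M0 c0 C0 gM phiD D_ge D_le.
have psi_cont := parametrization_continuous _ _ _ _ C'0 bilip.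
have S_psi := graph_image_parametrizes _ _ _ _ _ psi_cont
  Omega_open zbar_Omega S_graph phi_local.
split=> [[A gA]|[[limsupE _] [_ [L L_bij]]]].
  (* Direct implication: this map will be the strict derivative of the parametrization and the
     isomorphism of [X] onto the cone. *)
  have L_linear : linear (fun u => Dphi (u, A u)).
    move=> a u v.
    have -> : (a *: u + v, A (a *: u + v)) = a *: (u, A u) + (v, A v).
      by congr pair; exact: linearP.
    exact: linearP.
  pose L : {linear X -> Z} :=
    HB.pack (fun u => Dphi (u, A u)) (GRing.isLinear.Build _ _ _ _ _ L_linear).
  have L_inj u : L u = 0 -> u = 0 by move/D_inj => [].
  have psiL := graph_strict_derivative _ _ _ _ _ _ M0 C0 gM phiD D_le _
    (strict_hadamard_frechet _ _ _ gA).
  have [coneE cone_cont] :=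
    strict_derivative_cone _ _ _ _ _ L S_psi c20 C'0 bilip L_inj psiL.
  split=> //; rewrite coneE; split.
    split; first by rewrite !inE; exists 0 => //; rewrite linear0.
    move=> a _ _ /[!inE] -[u _ <-] [v _ <-]; exists (a *: u + v) => //.
    by rewrite linearP.
  exists L; split=> // u v _ _ /eqP.
  by rewrite -subr_eq0 -linearB => /eqP/L_inj/eqP; rewrite subr_eq0 => /eqP.
(* Converse: the candidate derivative [A] is read off the cone at [zbar], the range of [L]. *)
have [A L_graph] : exists A : {linear X -> Y},
    forall w, exists u, L w = Dphi (u, A u).
  apply: linear_subspace_is_graph Dphi_bij _ => w v Lw.
  have v0 : v = 0.
    apply/eqP; rewrite -normr_le0 -(mulr0 M) -(@normr0 _ X).
    apply: (graph_cone_norm_le _ _ _ _ _ _ _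
      M0 c0 C0 gM phiD D_ge D_le _ S_psi).
    by rewrite -Lw; have [+ _ _] := L_bij; apply.
  have [_ injL _] := L_bij; apply: injL; rewrite ?inE//.
  by rewrite Lw v0 !linear0.
exists A; apply: strict_frechet_hadamard; first exact: linear_continuous_fd.
apply: (cone_continuous_strict_derivative _ _ _ _ _ _ _
  M0 c0 C0 gM phiD D_ge D_le _ S_psi).
  by rewrite limsupE.
move=> h; have [_ _ surjL] := L_bij => /surjL[w _ <-]; exact: L_graph.
Qed.
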